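(* A real function $\rho:\mathbb{R}_+\to[0,1]$ is a mean field game equilibrium if and only if it is increasing, right-continuous and $$\rho(t)+F_t(r-c\rho(t))=1,\qquad t\ge0.$$
   Context: ''Increasing'' means non-decreasing. $(\Omega,\mathcal{G},P)$ is a probability space with a right-continuous filtration $\mathbb{G}=(\mathcal{G}_t)_{t\ge0}$; $r\in\mathbb{R}$ and $c>0$ are constants. $(I,\mathcal{I},\lambda)$ is an atomless probability space and $(I\times\Omega,\Sigma,\mu)$ is a Fubini extension of $(I\times\Omega,\mathcal{I}\otimes\mathcal{G},\lambda\otimes P)$, i.e. a probability space extending the product such that for every $\mu$-integrable $f$ the sections $f(i,\cdot)$ and $f(\cdot,\omega)$ are integrable for a.e. $i$ and a.e. $\omega$, and both iterated integrals exist and equal $\int f\,d\mu$. For each $i\in I$, the signal $Y^i$ is a $[0,\infty)$-valued, right-continuous, increasing, $\mathbb{G}$-progressively measurable process; for each $t\ge0$, $(i,\omega)\mapsto Y^i_t(\omega)$ is $\Sigma$-measurable and $(Y^i_t)_{i\in I}$ are $\lambda$-essentially pairwise i.i.d. (for $\lambda$-a.e. $i$, $Y^i_t$ is independent of $Y^j_t$ for $\lambda$-a.e. $j$, with common law), with c.d.f. $F_t(y)=P\{Y^i_t\le y\}$, assumed continuous in $y$. A (deterministic) function $\rho:\mathbb{R}_+\to[0,1]$ is a mean field game equilibrium if $\rho(t)=\lambda\{i:\tau^i\le t\}$ for all $t\ge0$ (equality with the random right-hand side being understood $P$-a.s., and the set being tacitly assumed measurable), where for $\lambda$-a.e. $i$,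 $\tau^i=\inf\{t\ge0:\alpha^i(t)\ge r\}$ with $\alpha^i(t)=Y^i_t+c\rho(t)$. Standing assumptions: the times $\tau^i$ are a.s. finite. (They are the minimal optimizers of $\sup_\tau E[e^{r\tau}\mathbf{1}_{\{\theta^i>\tau\}\cup\{\theta^i=\infty\}}]$ over $\mathbb{G}$-stopping times, $\theta^i=\inf\{t:\int_0^t\alpha^i(s)ds=\mathcal{E}\}$ with $\mathcal{E}$ exponential and independent of $\mathbb{G}$; this value is assumed finite.) *)

(* Defs.v *)
From HB Require Import structures.
From mathcomp Require Import all_boot all_order all_algebra.
From mathcomp Require Import all_classical all_reals all_analysis.

Set Implicit Arguments.
Unset Strict Implicit.
Unset Printing Implicit Defensive.

Import Order.TTheory GRing.Theory Num.Theory.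
Import numFieldNormedType.Exports.

Local Open Scope classical_set_scope.
Local Open Scope ring_scope.
Local Open Scope ereal_scope.

(* The time axis [0, +oo) is the subset [0 <= t] of [R]: functions of time are
   total on [R], and their values at negative times play no role. *)

Definition nondecreasing_time {R : realType} (f : R -> R) : Prop :=
  forall s t : R, (0 <= s)%R -> (s <= t)%R -> (f s <= f t)%R.

Definition right_continuous_time {R : realType} (f : R -> R) : Prop :=
  forall t : R, (0 <= t)%R -> f s @[s --> t^'+] --> f t.

Definition atomless d (T : measurableType d) (R : realType)
    (m : set T -> \bar R) : Prop :=
  forall A : set T, measurable A -> 0 < m A ->
    exists B : set T, [/\ measurable B, B `<=` A, 0 < m B & m B < m A].

Section filtrations.
Context d (Omega : measurableType d) (R : realType).
Implicit Type G : R -> set (set Omega).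

Definition right_continuous_filtration G : Prop :=
  [/\ forall t : R, (0 <= t)%R -> sigma_algebra setT (G t),
      forall t : R, (0 <= t)%R -> G t `<=` measurable,
      forall s t : R, (0 <= s)%R -> (s <= t)%R -> G s `<=` G t &
      forall t : R, (0 <= t)%R -> \bigcap_(s in [set s : R | (t < s)%R]) G s `<=` G t].

Definition progressively_measurable G (X : R -> Omega -> R) : Prop :=
  forall t : R, (0 <= t)%R ->
    measurable_fun (`[0%R, t] `*` setT : set (R * g_sigma_algebraType (G t)))
      (fun p : R * g_sigma_algebraType (G t) => X p.1 p.2).

Definition stopping_time G (tau : Omega -> \bar R) : Prop :=
  (forall w, 0 <= tau w) /\
  (forall t : R, (0 <= t)%R -> G t [set w | tau w <= t%:E]).

End filtrations.

Section random_variables.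
Context d (Omega : measurableType d) (R : realType) (P : probability Omega R).

Definition independent_pair (X Z : Omega -> R) : Prop :=
  forall A B : set R, measurable A -> measurable B ->
    P (X @^-1` A `&` Z @^-1` B) = P (X @^-1` A) * P (Z @^-1` B).

Definition same_law (X Z : Omega -> R) : Prop :=
  forall A : set R, measurable A -> P (X @^-1` A) = P (Z @^-1` A).

Definition independent_of_filtration (X : Omega -> R)
    (G : R -> set (set Omega)) : Prop :=
  forall (A : set Omega) (B : set R),
    <<s \bigcup_(t in [set t : R | (0 <= t)%R]) G t >> A -> measurable B ->
    P (A `&` X @^-1` B) = P A * P (X @^-1` B).

Definition essentially_pairwise_iid dI (I : measurableType dI)
    (lambda : probability I R) (X : I -> Omega -> R) : Prop :=
  {ae lambda, forall i, {ae lambda, forall j,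
    independent_pair (X i) (X j) /\ same_law (X i) (X j)}}.

End random_variables.

Section fubini_extension.
Context dI dO (I : measurableType dI) (Omega : measurableType dO) (R : realType).

(* Partial integrals are only defined up to null sets, and the measures need not
   be complete: [has_ae_integral m h v] says that [h] agrees a.e. with an
   integrable function whose integral is [v]. *)
Definition has_ae_integral d (T : measurableType d) (m : {measure set T -> \bar R})
    (h : T -> \bar R) (v : \bar R) : Prop :=
  exists g : T -> \bar R,
    [/\ m.-integrable setT g, {ae m, forall x, g x = h x} &
        \int[m]_x g x = v].

Definition is_fubini_extension (lambda : probability I R)
    (P : probability Omega R) (Sigma : set (set (I * Omega)))
    (mu : probability (g_sigma_algebraType Sigma) R) : Prop :=
  [/\ sigma_algebra setT Sigma,
      (forall A : set (I * Omega), measurable A ->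
         Sigma A /\ mu A = (lambda \x P) A) &
      forall f : I * Omega -> R,
        mu.-integrable setT (fun p : g_sigma_algebraType Sigma => (f p)%:E) ->
        [/\ {ae lambda, forall i, P.-integrable setT (fun w => (f (i, w))%:E)},
            {ae P, forall w, lambda.-integrable setT (fun i => (f (i, w))%:E)},
            has_ae_integral lambda (fun i => \int[P]_w (f (i, w))%:E)
              (\int[mu]_p (f p)%:E) &
            has_ae_integral P (fun w => \int[lambda]_i (f (i, w))%:E)
              (\int[mu]_p (f p)%:E)]].

End fubini_extension.

Section stopping_game.
Context d (Omega : measurableType d) (R : realType).
Implicit Types (alpha : R -> Omega -> R) (rho : R -> R).

Definition intensity (c : R) (X : R -> Omega -> R) rho : R -> Omega -> R :=
  fun t w => (X t w + c * rho t)%R.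

(* The infimum of the empty set is [+oo]. *)
Definition hitting_time (r : R) alpha (w : Omega) : \bar R :=
  ereal_inf [set t%:E | t in [set t : R | (0 <= t)%R /\ (r <= alpha t w)%R]].

Definition default_time (clock : Omega -> R) alpha (w : Omega) : \bar R :=
  ereal_inf [set t%:E | t in [set t : R | (0 <= t)%R /\
    \int[lebesgue_measure]_(s in `[0%R, t]) (alpha s w)%:E = (clock w)%:E]].

(* On [tau = +oo], [expeR (r * tau)] is [+oo], [1] or [0] according to whether
   [r] is positive, zero or negative. *)
Definition stopping_value (P : probability Omega R) (G : R -> set (set Omega))
    (r : R) (clock : Omega -> R) alpha : \bar R :=
  let theta := default_time clock alpha in
  ereal_sup [set \int[P]_w (expeR (r%:E * tau w) *
      (\1_[set w' | (tau w' < theta w')%E \/ theta w' = +oo%E] w)%:E)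
    | tau in stopping_time G].

End stopping_game.

Section equilibrium.
Context dI dO (I : measurableType dI) (Omega : measurableType dO) (R : realType).

(* The [tau i] are only prescribed for almost every [i], hence the existential. *)
Definition mean_field_equilibrium (lambda : probability I R)
    (P : probability Omega R) (r c : R) (Y : I -> R -> Omega -> R)
    (rho : R -> R) : Prop :=
  exists tau : I -> Omega -> \bar R,
    {ae lambda, forall i,
       forall w, tau i w = hitting_time r (intensity c (Y i) rho) w} /\
    (forall t : R, (0 <= t)%R -> {ae P, forall w,
       measurable [set i | tau i w <= t%:E] /\
       (rho t)%:E = lambda [set i | tau i w <= t%:E]}).

End equilibrium.

(* Main.v *)
Require Import Defs.
From HB Require Import structures.
From mathcomp Require Import all_boot all_order all_algebra.
From mathcomp Require Import all_classical all_reals all_analysis.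
From mathcomp Require Import measurable_realfun ring lra.

Set Implicit Arguments.
Unset Strict Implicit.
Unset Printing Implicit Defensive.

Import Order.TTheory GRing.Theory Num.Theory.
Import numFieldNormedType.Exports.
Local Open Scope classical_set_scope.
Local Open Scope ring_scope.

(** Once [rho] is nondecreasing and right-continuous, so is the intensity
    [Y i t + c * rho t], and then stopping has occurred by time [t] exactly when
    the intensity is at least [r] at [t], i.e. when [r - c * rho t <= Y i t]
    ([hitting_time_le]). The proportion of stopped agents is therefore the
    proportion of signals above the level [r - c * rho t]. By the exact law of
    large numbers on the Fubini extension this proportion is a.s. the
    probability [1 - F t (r - c * rho t)] of a single signal being above that
    level ([section_frequency_const]; continuity of [F t] makes strict and weak
    inequalities equally likely, [probability_ge_continuous_cdf]). So the fixed
    point equation says precisely that [rho t] is the proportion of agents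
    stopped by [t].

    Monotonicity and right-continuity come for free in an equilibrium: along one
    well-chosen sample point, [rho] is the distribution function of
    [i |-> tau i w] at any countable set of times.

    The law of large numbers is a second-moment computation. Let
    [g w := \int[lambda]_i u (i, w)] be the sample mean of a bounded [u] whose
    sections [u (i, .)] have mean [m] and satisfy [E (u_i * u_j) = m ^+ 2] for
    almost all [i], [j]. Exchanging the integrals three times gives [E g = m],
    then [E (u_j * g) = m ^+ 2] for almost every [j], then [E (g * g) = m ^+ 2].
    Hence [E (g - m) ^+ 2 = 0] and [g = m] almost surely. *)

(** * Integrals against finite measures *)

Lemma integral_cst_probability d (T : measurableType d) (R : realType)
    (P : probability T R) (x : \bar R) : (\int[P]_w cst x w = x)%E.
Proof.
by rewrite integral_cst// -[RHS]mule1; congr (_ * _)%E; exact: probability_setT.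
Qed.

Lemma bounded_integrable d (T : measurableType d) (R : realType)
    (m : {finite_measure set T -> \bar R}) (f : T -> R) (M : R) :
  measurable_fun setT f -> (forall x, `|f x| <= M) ->
  m.-integrable setT (fun x => (f x)%:E).
Proof.
move=> mf fM; apply: measurable_bounded_integrable => //.
  by rewrite ltey_eq fin_num_measure.
exists M; split=> [|y /ltW My x _]; [exact: num_real|].
exact: le_trans (fM x) My.
Qed.

(** * The exact law of large numbers on a Fubini extension *)

Section fubini_extension_theory.
Context (R : realType) (dI dO : measure_display).
Context (I : measurableType dI) (Omega : measurableType dO).
Context (lambda : probability I R) (P : probability Omega R).
Context (Sigma : set (set (I * Omega))).
Context (mu : probability (g_sigma_algebraType Sigma) R).
Hypothesis hmu : is_fubini_extension lambda P mu.

Let S := g_sigma_algebraType Sigma.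

Lemma measurable_fun_snd_extension (k : Omega -> R) :
  measurable_fun setT k -> measurable_fun setT (fun p : S => k p.2).
Proof.
move=> mk _ B mB; rewrite setTI.
apply: sub_sigma_algebra; have [_ prodS _] := hmu.
have mkB : measurable (k @^-1` B) by rewrite -[_ @^-1` _]setTI; exact: mk.
have -> : (fun p : S => k p.2) @^-1` B = setT `*` (k @^-1` B).
  by apply/seteqP; split=> [p ?|p []].
by have [] := prodS _ (measurableX measurableT mkB).
Qed.

(** The exchange of integrals in the form used here: both partial integrals are
    known almost everywhere, one of them being the constant [v]. Comparing them
    with the integrable versions supplied by the Fubini property shows that
    [v] and the mean of [g] both equal the integral of [u] over the extension. *)
Lemma integral_section_means (u : I * Omega -> R) (M v : R) (g : Omega -> R) :
  measurable_fun setT (u : S -> R) -> (forall p, `|u p| <= M) ->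
  {ae lambda, forall i, (\int[P]_w (u (i, w))%:E = v%:E)%E} ->
  measurable_fun setT g ->
  {ae P, forall w, (\int[lambda]_i (u (i, w))%:E = (g w)%:E)%E} ->
  (\int[P]_w (g w)%:E = v%:E)%E.
Proof.
move=> meas_u uM uv mg ug; have [_ _ fub] := hmu.
have [_ _ [a [ia au intu]] [b [ib bu intu']]] :=
  fub u (bounded_integrable mu meas_u uM).
have -> : (\int[P]_w (g w)%:E = \int[P]_w b w)%E.
  apply: ae_eq_integral => //; first exact/measurable_EFinP.
    exact: measurable_int ib.
  by apply: filterS2 bu ug => w bw gw _; rewrite bw.
rewrite intu' -intu.
transitivity (\int[lambda]_i (cst v%:E i))%E.
  apply: ae_eq_integral => //; first exact: measurable_int ia.
  by apply: filterS2 au uv => i ai ui _; rewrite ai.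
exact: integral_cst_probability.
Qed.

(** The partial integral is only a.e. equal to some integrable, extended real
    function. Truncating that function at the bound [M] of [u] changes it on a
    null set only, and makes the sample mean an everywhere bounded real random
    variable, which can be multiplied with sections of [u]. *)
Lemma section_mean_version (u : I * Omega -> R) (M : R) :
  measurable_fun setT (u : S -> R) -> (forall p, `|u p| <= M) ->
  exists g : Omega -> R, [/\ measurable_fun setT g, forall w, `|g w| <= M &
    {ae P, forall w, (\int[lambda]_i (u (i, w))%:E = (g w)%:E)%E}].
Proof.
move=> meas_u uM; have [_ _ fub] := hmu.
have [_ isec _ [b [ib bu _]]] := fub u (bounded_integrable mu meas_u uM).
have mb := measurable_int _ ib.
exists (fun w => Num.max (- M) (Num.min M (fine (b w)))); split.
- apply: measurable_maxr => //; apply: measurable_minr => //.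
  exact: measurableT_comp (fine_measurable measurableT) mb.
- move=> w; have M0 : 0 <= M by apply: le_trans (uM (point, w)).
  rewrite ler_norml le_max lexx/= ge_max ge_min lexx/=.
  by rewrite andbT; lra.
apply: filterS2 bu isec => w bw iw.
have M0 : 0 <= M by apply: le_trans (uM (point, w)).
have : (`|\int[lambda]_i (u (i, w))%:E| <= M%:E)%E.
  apply: le_trans (le_abse_integral _ measurableT (measurable_int _ iw)) _.
  rewrite -[leRHS]mule1 -[X in (_ * X)%E](probability_setT lambda).
  apply: integral_le_bound => //; first exact: measurable_int iw.
  by apply: aeW => i _; rewrite lee_fin.
rewrite -bw; case: (b w) => [x| |] //=; rewrite lee_fin ler_norml => /andP[Mx xM].
by congr EFin; rewrite (min_idPr xM) (max_idPr Mx).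
Qed.

(** The exact law of large numbers: integrating out the index kills the whole
    variance of the sample mean [g], since the pairs of correlated indices are
    negligible. Pairwise uncorrelatedness is enough. *)
Lemma section_mean_const (u : I * Omega -> R) (M m : R) :
  measurable_fun setT (u : S -> R) -> (forall p, `|u p| <= M) ->
  {ae lambda, forall i, (\int[P]_w (u (i, w))%:E = m%:E)%E} ->
  {ae lambda, forall i, {ae lambda, forall j,
    (\int[P]_w (u (i, w) * u (j, w))%:E = (m ^+ 2)%:E)%E}} ->
  {ae P, forall w, (\int[lambda]_i (u (i, w))%:E = m%:E)%E}.
Proof.
move=> meas_u uM um uu; have [g [mg gM ug]] := section_mean_version meas_u uM.
have [_ _ fub] := hmu.
have [isecP iseclam _ _] := fub u (bounded_integrable mu meas_u uM).
have M0 : 0 <= M by apply: le_trans (uM (point, point)).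
have MM x y : `|x| <= M -> `|y| <= M -> `|x * y| <= M * M.
  by move=> xM yM; rewrite normrM ler_pM.
have intg := integral_section_means meas_u uM um mg ug.
(* freeze one index [j] and integrate [u (i, w) * u (j, w)] over [i] first *)
have intug : {ae lambda, forall j,
    (\int[P]_w (u (j, w) * g w)%:E = (m ^+ 2)%:E)%E}.
  apply: filterS2 isecP uu => j jP uuj.
  have muj : measurable_fun setT (fun w => u (j, w)).
    exact/measurable_EFinP/(measurable_int _ jP).
  apply: (@integral_section_means (fun p => u (j, p.2) * u p) (M * M)).
  - apply: measurable_funM => //; exact: measurable_fun_snd_extension muj.
  - by move=> p; apply: MM.
  - by [].
  - exact: measurable_funM.
  apply: filterS2 iseclam ug => w iw gw /=.
  under eq_integral do rewrite EFinM.
  by rewrite integralZl// gw -EFinM.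
(* now let [j] vary in the identity just obtained, and integrate it out too *)
have intgg : (\int[P]_w (g w * g w)%:E = (m ^+ 2)%:E)%E.
  apply: (@integral_section_means (fun p => u p * g p.2) (M * M)).
  - apply: measurable_funM => //; exact: measurable_fun_snd_extension.
  - by move=> p; apply: MM.
  - by [].
  - exact: measurable_funM.
  apply: filterS2 iseclam ug => w iw gw /=.
  under eq_integral do rewrite EFinM.
  by rewrite integralZr// gw -EFinM.
have igg : P.-integrable setT (fun w => (g w * g w)%:E).
  apply: (@bounded_integrable _ _ _ P _ (M * M)); first exact: measurable_funM.
  by move=> w; exact: MM.
have ig : P.-integrable setT (fun w => (g w)%:E).
  exact: (bounded_integrable P mg gM).
have var0 : (\int[P]_w `|((g w - m) ^+ 2)%:E| = 0)%E.
  transitivity (\int[P]_w ((g w * g w)%:E +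
    ((- (2 * m))%:E * (g w)%:E + cst (m ^+ 2)%:E w)))%E.
    apply: eq_integral => w _; rewrite gee0_abs ?lee_fin ?sqr_ge0//=.
    by rewrite -EFinM -!EFinD; congr EFin; ring.
  have ic : P.-integrable setT (cst (m ^+ 2)%:E).
    exact: finite_measure_integrable_cst.
  rewrite integralD//; last by apply: integrableD => //; exact: integrableZl.
  rewrite integralD//; last exact: integrableZl.
  rewrite integralZl// intgg intg integral_cst_probability.
  by rewrite -EFinM -!EFinD; congr EFin; ring.
have mvar : measurable_fun setT (fun w => ((g w - m) ^+ 2)%:E).
  apply/measurable_EFinP; apply: (measurable_funX 2); exact: measurable_funB.
have [/(_ var0) gm _] := ae_eq_integral_abs P measurableT mvar.
apply: filterS2 ug gm => w -> /(_ Logic.I) [] /eqP.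
by rewrite sqrf_eq0 subr_eq0 => /eqP ->.
Qed.

(** The law of large numbers for the indicator of [A]. The Fubini property also
    yields the measurability of almost every section of [A], in both
    directions, although [A] need not be measurable for the product. *)
Lemma section_frequency_const (A : set (I * Omega)) (m : R) :
  measurable (A : set S) ->
  {ae lambda, forall i, P [set w | A (i, w)] = m%:E} ->
  {ae lambda, forall i, {ae lambda, forall j,
    P ([set w | A (i, w)] `&` [set w | A (j, w)]) =
    (P [set w | A (i, w)] * P [set w | A (j, w)])%E}} ->
  {ae P, forall w, measurable [set i | A (i, w)] /\
    lambda [set i | A (i, w)] = m%:E}.
Proof.
move=> mA Am Aind; set u := (\1_A : I * Omega -> R).
have meas_u : measurable_fun setT (u : S -> R) by exact: measurable_indic.
have uM p : `|u p| <= 1.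
  by rewrite /u indicE; case: (p \in A); rewrite ?normr1 ?normr0.
have [_ _ fub] := hmu.
have [isecP iseclam _ _] := fub u (bounded_integrable mu meas_u uM).
(* sections of [A] are level sets of the corresponding sections of [u] *)
have mA1 d (T : measurableType d) (h : T -> I * Omega) (Q : probability T R) :
    Q.-integrable setT (fun x => (u (h x))%:E) -> measurable (h @^-1` A).
  move=> /measurable_int/measurable_EFinP mh.
  have -> : h @^-1` A = (u \o h) @^-1` [set 1].
    apply/seteqP; split=> x /=; rewrite /u indicE.
      by move=> Ax; rewrite mem_set.
    by case: (boolP (h x \in A)) => [/set_mem//|_ /eqP]; rewrite eq_sym oner_eq0.
  by rewrite -[_ @^-1` _]setTI; exact: mh.
have mAP : {ae lambda, forall i, measurable [set w | A (i, w)]}.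
  by apply: filterS isecP => i; exact: mA1.
have secI d (T : measurableType d) (Q : probability T R) (h : T -> I * Omega) :
    measurable (h @^-1` A) -> (\int[Q]_x (u (h x))%:E = Q (h @^-1` A))%E.
  by move=> mh; rewrite -[in RHS](setIT (h @^-1` A)) -integral_indic.
have um : {ae lambda, forall i, (\int[P]_w (u (i, w))%:E = m%:E)%E}.
  by apply: filterS2 mAP Am => i mi; rewrite (secI _ _ P (fun w => (i, w))).
have uu : {ae lambda, forall i, {ae lambda, forall j,
    (\int[P]_w (u (i, w) * u (j, w))%:E = (m ^+ 2)%:E)%E}}.
  have [mAP2 Am2] := (mAP, Am); apply: filterS3 mAP2 Am2 Aind => i mi ai.
  apply: filterS3 mAP Am => j mj aj aij.
  have mij := measurableI _ _ mi mj.
  rewrite expr2 EFinM -{1}ai -aj -aij -[X in P X]setIT -integral_indic//.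
  by apply: eq_integral => w _; rewrite indicI.
apply: filterS2 iseclam (section_mean_const meas_u uM um uu) => w iw.
have mw := mA1 _ _ (fun i => (i, w)) _ iw.
by rewrite (secI _ _ lambda (fun i => (i, w))).
Qed.

End fubini_extension_theory.

(** * Null sets *)

Lemma measure_ae_eq d (T : measurableType d) (R : realType)
    (m : {measure set T -> \bar R}) (A B : set T) :
  measurable A -> measurable B -> {ae m, forall x, A x <-> B x} -> m A = m B.
Proof.
move=> mA mB AB; rewrite -[A]setIT -[B]setIT -!integral_indic//.
apply: ae_eq_integral => //; [exact/measurable_EFinP/measurable_indic..|].
apply: filterS AB => x AB _; rewrite !indicE.
by have -> : (x \in A) = (x \in B) by apply/idP/idP; rewrite !inE => /AB.
Qed.

Lemma probability_ae_ex d (T : measurableType d) (R : realType)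
    (P : probability T R) (Q : T -> Prop) :
  {ae P, forall x, Q x} -> exists x, Q x.
Proof.
have P0 : (0 < P [set: T])%E by rewrite (@probability_setT _ _ _ P) lte01.
have := ae_properfilter_algebraOfSetsType P0 => pf.
exact: filter_ex.
Qed.

(** * The signals at a fixed time *)

(** [{X < y}] is the increasing union of the events [{X <= y - 1/(n+1)}], so its
    probability is the left limit of [F] at [y], which is [F y]. *)
Lemma probability_ge_continuous_cdf d (T : measurableType d) (R : realType)
    (P : probability T R) (X : T -> R) (F : R -> R) :
  measurable_fun setT X -> continuous F ->
  (forall y, P [set w | X w <= y] = (F y)%:E) ->
  forall y, P [set w | y <= X w] = (1 - F y)%:E.
Proof.
move=> mX cF PF y.
have mle z : measurable [set w | X w <= z].
  have -> : [set w | X w <= z] = X @^-1` `]-oo, z].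
    by apply/seteqP; split=> w /=; rewrite in_itv.
  by rewrite -[_ @^-1` _]setTI; exact: mX.
have ltE : [set w | X w < y] = \bigcup_n [set w | X w <= y - n.+1%:R^-1].
  apply/seteqP; split=> w /=.
    move=> /ltr_add_invr[n Xn]; exists n => //=; rewrite lerBrDr; exact: ltW.
  by move=> [n _] /= /le_lt_trans; apply; rewrite ltrBlDr ltrDl invr_gt0.
have mlt : measurable [set w | X w < y] by rewrite ltE; exact: bigcup_measurable.
have lim1 : P [set w | X w <= y - n.+1%:R^-1] @[n --> \oo] -->
    P [set w | X w < y].
  rewrite ltE; apply: nondecreasing_cvg_mu => //; first by rewrite -ltE.
  move=> n k nk; apply/subsetPset => w /= /le_trans; apply.
  by rewrite lerD2l lerN2 lef_pV2 ?posrE// ler_nat ltnS.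
have lim2 : P [set w | X w <= y - n.+1%:R^-1] @[n --> \oo] --> (F y)%:E.
  under eq_fun do rewrite PF.
  apply: cvg_EFin; first exact: nearW.
  apply: (@continuous_cvg _ _ _ _ _ _ F); first exact: cF.
  rewrite -[X in _ --> X]subr0; apply: cvgB; first exact: cvg_cst.
  exact: cvg_harmonic.
have -> : [set w | y <= X w] = ~` [set w | X w < y].
  by apply/seteqP; split=> w /=; rewrite leNgt => /negP.
by rewrite probability_setC// (cvg_unique _ lim1 lim2).
Qed.

Lemma progressively_measurable_marginal d (Omega : measurableType d)
    (R : realType) (G : R -> set (set Omega)) (X : R -> Omega -> R) :
  right_continuous_filtration G -> progressively_measurable G X ->
  forall t, 0 <= t -> measurable_fun setT (X t).
Proof.
move=> [Gs Gm _ _] pX t t0 _ B mB; rewrite setTI.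
have mT : measurable (`[0%R, t] `*` setT : set (R * g_sigma_algebraType (G t))).
  exact: measurableX.
have := measurable_xsection t (pX t t0 mT B mB).
rewrite /measurable/= (sigma_algebra_id (Gs t t0)) => /(Gm t t0).
congr measurable; apply/seteqP; split=> w /=; rewrite /xsection/= inE/=; last first.
  by move=> XB; split=> //; split=> //=; rewrite in_itv/= t0 lexx.
by case.
Qed.

(** * Hitting times of nondecreasing right-continuous intensities *)

(** The infimum is attained by right-continuity, and by monotonicity the level
    stays reached afterwards. *)
Lemma hitting_time_le d (Omega : measurableType d) (R : realType) (r : R)
    (alpha : R -> Omega -> R) (w : Omega) (t : R) :
  0 <= t -> nondecreasing_time (alpha ^~ w) ->
  right_continuous_time (alpha ^~ w) ->
  (hitting_time r alpha w <= t%:E)%E <-> r <= alpha t w.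
Proof.
move=> t0 ainc arc; split; last first.
  by move=> rt; apply: ereal_inf_lbound; exists t.
apply: contraPP => /negP; rewrite -ltNge => atr.
have [e /= e0 ae] := cvgr_lt _ (arc t t0) _ atr.
move=> /le_lt_trans => /(_ (t + e)%:E); rewrite lte_fin ltrDl => /(_ e0).
move=> /ereal_inf_lt[_ [s [s0 rs] <-]]; rewrite lte_fin => ste.
have [st|ts] := leP s t.
  by have := le_lt_trans (le_trans rs (ainc _ _ s0 st)) atr; rewrite ltxx.
have := ae s; rewrite /ball_/= distrC gtr0_norm ?subr_gt0// ltrBlDl => /(_ ste ts).
by rewrite ltNge rs.
Qed.

(** * Regularity of an equilibrium *)

Section frequency_of_default.
Context (R : realType) (dI dO : measure_display).
Context (I : measurableType dI) (Omega : measurableType dO).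
Context (lambda : probability I R) (P : probability Omega R).
Context (tau : I -> Omega -> \bar R) (rho : R -> R).
Hypothesis rhoE : forall t : R, 0 <= t -> {ae P, forall w,
  measurable [set i | (tau i w <= t%:E)%E] /\
  (rho t)%:E = lambda [set i | (tau i w <= t%:E)%E]}.

(** The identity [rhoE] holds outside a null set that depends on the time; since
    finitely or countably many null sets do not cover [Omega], any countable set
    of times can be treated at a common sample point [w]. *)
Lemma frequency_nondecreasing : nondecreasing_time rho.
Proof.
move=> s t s0 st; have t0 := le_trans s0 st.
have [w [[ms rs] [mt rt]]] := probability_ae_ex (filterI (rhoE s0) (rhoE t0)).
rewrite -lee_fin rs rt; apply: le_measure; rewrite ?inE// => i /= /le_trans.
by apply; rewrite lee_fin.
Qed.

(** Continuity of [lambda] from above handles the sequence [t + 1/(n+1)], for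
    which a common sample point exists; monotonicity extends the limit to all
    times decreasing to [t]. *)
Lemma frequency_right_continuous : right_continuous_time rho.
Proof.
move=> t t0; pose u n : R := t + n.+1%:R^-1.
have tu n : t < u n by rewrite ltrDl invr_gt0.
have u0 n : 0 <= u n by exact: le_trans t0 (ltW (tu n)).
have [w [[mt rt] wu]] := probability_ae_ex
  (filterI (rhoE t0) (ae_foralln (fun n => rhoE (u0 n)))).
have capE : \bigcap_n [set i | (tau i w <= (u n)%:E)%E] =
    [set i | (tau i w <= t%:E)%E].
  apply/seteqP; split=> i /= h; last first.
    by move=> n _ /=; apply: le_trans h _; rewrite lee_fin ltW.
  apply/lee_addgt0Pr => e e0.
  have [n ne] : exists n, t + n.+1%:R^-1 < t + e.
    by apply: ltr_add_invr; rewrite ltrDl.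
  by apply: le_trans (h n Logic.I) _; rewrite -EFinD lee_fin ltW.
have cvgu : rho (u n) @[n --> \oo] --> rho t.
  suff : (rho (u n))%:E @[n --> \oo] --> (rho t)%:E by move/fine_cvg.
  rewrite rt -capE; under eq_fun do rewrite (wu _).2.
  apply: nonincreasing_cvg_mu => //.
  - by rewrite ltey_eq fin_num_measure//; case: (wu 0%N).
  - by move=> n; case: (wu n).
  - by rewrite capE.
  move=> n k nk; apply/subsetPset => i /= /le_trans; apply.
  by rewrite lee_fin lerD2l lef_pV2 ?posrE// ler_nat ltnS.
apply/cvgrPdist_lt => e e0.
move/cvgrPdist_lt: cvgu => /(_ e e0)[n _ /(_ n (leqnn n))/= rn].
near=> s.
have ts : t < s by near: s; exact: nbhs_right_gt.
have su : s <= u n by near: s; exact: nbhs_right_le.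
have rts := frequency_nondecreasing t0 (ltW ts).
have rsu := frequency_nondecreasing (le_trans t0 (ltW ts)) su.
move: rn; rewrite !ler0_norm ?subr_le0//; last exact: le_trans rsu.
by apply: le_lt_trans; rewrite !opprB lerD2r.
Unshelve. all: by end_near.
Qed.

End frequency_of_default.

(** * The characterization *)

Theorem proposition4p1 (R : realType) (dI dO : measure_display)
  (I : measurableType dI) (Omega : measurableType dO)
  (lambda : probability I R) (P : probability Omega R)
  (Sigma : set (set (I * Omega)))
  (mu : probability (g_sigma_algebraType Sigma) R)
  (G : R -> set (set Omega))
  (clock : {RV P >-> R})
  (Y : I -> R -> Omega -> R)
  (F : R -> R -> R) (r c : R) (rho : R -> R)
  (hc : 0 < c)
  (hlambda : atomless lambda)
  (hmu : is_fubini_extension lambda P mu)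
  (hG : right_continuous_filtration G)
  (hclock : forall B : set R, measurable B ->
     distribution P clock B = exponential_prob 1 B)
  (hclockG : independent_of_filtration P clock G)
  (hY0 : forall i (t : R) w, 0 <= t -> 0 <= Y i t w)
  (hYrc : forall i w, right_continuous_time (fun t => Y i t w))
  (hYincr : forall i w, nondecreasing_time (fun t => Y i t w))
  (hYprog : forall i, progressively_measurable G (Y i))
  (hYjoint : forall t : R, 0 <= t ->
     measurable_fun setT (fun p : g_sigma_algebraType Sigma => Y p.1 t p.2))
  (hYiid : forall t : R, 0 <= t ->
     essentially_pairwise_iid P lambda (fun i => Y i t))
  (hF : forall t : R, 0 <= t -> {ae lambda, forall i,
     forall y : R, P [set w | Y i t w <= y] = (F t y)%:E})
  (hFcont : forall t : R, 0 <= t -> continuous (F t))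
  (hrho : forall t : R, 0 <= t -> 0 <= rho t <= 1)
  (htau : {ae lambda, forall i, {ae P, forall w,
     (hitting_time r (intensity c (Y i) rho) w < +oo)%E}})
  (* the stopping problem only makes sense for measurable [rho] *)
  (hvalue : measurable_fun `[(0 : R), +oo[ rho -> {ae lambda, forall i,
     (stopping_value P G r clock (intensity c (Y i) rho) < +oo)%E}) :
  mean_field_equilibrium lambda P r c Y rho <->
  [/\ nondecreasing_time rho,
      right_continuous_time rho &
      forall t : R, 0 <= t -> rho t + F t (r - c * rho t) = 1].

Proof.
have lln (t y : R) : 0 <= t -> {ae P, forall w,
    measurable [set i | y <= Y i t w] /\
    lambda [set i | y <= Y i t w] = (1 - F t y)%:E}.
  move=> t0.
  apply: (section_frequency_const hmu (A := [set p | y <= Y p.1 t p.2])).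
  - have -> : [set p | y <= Y p.1 t p.2] =
        (fun p : g_sigma_algebraType Sigma => Y p.1 t p.2) @^-1` `[y, +oo[.
      by apply/seteqP; split=> p /=; rewrite in_itv/= andbT.
    rewrite -[_ @^-1` _]setTI; exact: hYjoint.
  - apply: filterS (hF t t0) => i Fi.
    apply: probability_ge_continuous_cdf (hFcont t t0) Fi y.
    exact: progressively_measurable_marginal hG (hYprog i) t t0.
  - apply: filterS (hYiid t t0) => i; apply: filterS => j [ij _].
    have := ij _ _ (measurable_itv `[y, +oo[) (measurable_itv `[y, +oo[).
    have E k : Y k t @^-1` `[y, +oo[ = [set w | y <= Y k t w].
      by apply/seteqP; split=> w /=; rewrite in_itv/= andbT.
    by rewrite !E.
have hit_le i w t : nondecreasing_time rho -> right_continuous_time rho ->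
    0 <= t -> (hitting_time r (intensity c (Y i) rho) w <= t%:E)%E <->
    r - c * rho t <= Y i t w.
  move=> rinc rrc t0; rewrite hitting_time_le//; last 2 first.
  - by move=> s u s0 su; rewrite lerD// ?hYincr// ler_pM2l// rinc.
  - move=> s s0; apply: cvgD; first exact: hYrc.
    by apply: cvgMr; exact: rrc.
  by rewrite lerBlDr.
split=> [[tau [tauE rhoE]]|[rinc rrc rF]].
  have rinc := frequency_nondecreasing rhoE.
  have rrc := frequency_right_continuous rhoE.
  split=> // t t0.
  have [w [[mtau rt] [mY YF]]] :=
    probability_ae_ex (filterI (rhoE t t0) (lln t (r - c * rho t) t0)).
  suff : (rho t)%:E = (1 - F t (r - c * rho t))%:E.
    by case=> e; rewrite {1}e subrK.
  rewrite rt -YF; apply: measure_ae_eq => //.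
  by apply: filterS tauE => i /= ->; exact: hit_le.
exists (fun i => hitting_time r (intensity c (Y i) rho)).
split=> [|t t0]; first exact: aeW.
apply: filterS (lln t (r - c * rho t) t0) => w.
have -> : [set i | (hitting_time r (intensity c (Y i) rho) w <= t%:E)%E] =
    [set i | r - c * rho t <= Y i t w].
  by apply/seteqP; split=> i; apply hit_le.
by move=> [mY ->]; split=> //; rewrite -(rF t t0) addrK.
Qed.
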